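(* For every integer $n\ge 3$, the $C^*$-algebra $C(\mathrm{Qut}(\mathcal U_{K_n}))$ is non-commutative.
   Context: $K_n$ is the complete graph on $n$ vertices. For a unital $C^*$-algebra $\mathcal B$, a matrix $U=(u_{i,j})_{i,j=1}^n\in M_n(\mathcal B)$ is a bi-unitary if both $U$ and $U^t=(u_{j,i})_{i,j=1}^n$ are unitary in $M_n(\mathcal B)$. Consider the universal unital $C^*$-algebra generated by elements $u_{i,j}$, $1\le i,j\le n$, subject to the relations that $U=(u_{i,j})_{i,j=1}^n$ is a bi-unitary, $u_{i,k}u_{i,l}^*=0$ for $k\ne l$, and $u_{i,k}u_{j,k}^*=0$ for $i\ne j$. The algebra $C(\mathrm{Qut}(\mathcal U_{K_n}))$ is its $C^*$-subalgebra generated by all the words $u_{i,j}^*u_{k,l}$, $1\le i,j,k,l\le n$. *)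

(* Defs.v *)
From HB Require Import structures.
From mathcomp Require Import all_boot all_order all_algebra.
From mathcomp Require Import complex.
From mathcomp Require Import all_classical all_reals all_analysis.
Set Implicit Arguments.
Unset Strict Implicit.
Unset Printing Implicit Defensive.
Import Order.TTheory GRing.Theory Num.Theory.
Import numFieldNormedType.Exports.
Local Open Scope classical_set_scope.
Local Open Scope ring_scope.

(* The norm is part of this mixin because Hierarchy Builder admits no join of
   the noncommutative rings with the normed modules: numDomainType already is
   the join of rings and of normed Z-modules.  Its values are real numbers and
   completeness is stated with Cauchy sequences. *)
HB.mixin Record isCStarAlgebra (R : realType) A of GRing.Algebra R[i] A := {
  star : A -> A ;
  cnorm : A -> R ;
  starK : involutive star ;
  starD : {morph star : a b / a + b} ;
  starZ : forall (z : R[i]) (a : A), star (z *: a) = z^*%C *: star a ;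
  starM : forall a b : A, star (a * b) = star b * star a ;
  cnorm0_eq0 : forall a : A, cnorm a = 0 -> a = 0 ;
  cnormD_le : forall a b : A, cnorm (a + b) <= cnorm a + cnorm b ;
  cnormZ : forall (z : R[i]) (a : A),
    cnorm (z *: a) = ComplexField.Normc.normc z * cnorm a ;
  cnormM_le : forall a b : A, cnorm (a * b) <= cnorm a * cnorm b ;
  cnorm_starM : forall a : A, cnorm (star a * a) = cnorm a ^+ 2 ;
  cnorm_complete : forall x : nat -> A,
    (forall e : R, 0 < e -> exists N : nat, forall m n : nat,
       (N <= m)%N -> (N <= n)%N -> cnorm (x m - x n) < e) ->
    exists l : A, cnorm (x n - l) @[n --> \oo] --> (0 : R)
}.

(* Unital C*-algebras.  Algebras of the library satisfy 1 != 0, so the zero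
   algebra is excluded. *)
#[short(type="cstarAlgType")]
HB.structure Definition CStarAlgebra (R : realType) :=
  {A of GRing.Algebra R[i] A & isCStarAlgebra R A}.

Section CStarSubalgebras.
Context {R : realType} {A : cstarAlgType R}.

Definition norm_closed (S : set A) : Prop :=
  forall (x : nat -> A) (l : A), (forall n, S (x n)) ->
    cnorm (x n - l) @[n --> \oo] --> (0 : R) -> S l.

(* Not required to contain 1. *)
Definition is_cstar_subalgebra (S : set A) : Prop :=
  [/\ S 0 /\ (forall (z : R[i]) a b, S a -> S b -> S (z *: a + b)),
      forall a b, S a -> S b -> S (a * b),
      forall a, S a -> S (star a)
    & norm_closed S].

Definition cstar_generated (G : set A) : set A :=
  smallest is_cstar_subalgebra G.

Definition noncommutative (S : set A) : Prop :=
  ~ (forall a b, S a -> S b -> a * b = b * a).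

End CStarSubalgebras.

Section Relations.
Context {R : realType} {B : cstarAlgType R} {n : nat}.

Definition mx_star (U : 'M[B]_n) : 'M[B]_n := \matrix_(i, j) star (U j i).

Definition unitary (U : 'M[B]_n) : Prop :=
  mx_star U *m U = 1%:M /\ U *m mx_star U = 1%:M.

Definition biunitary (U : 'M[B]_n) : Prop := unitary U /\ unitary U^T.

Definition UKn_relations (u : 'M[B]_n) : Prop :=
  [/\ biunitary u,
      forall i k l : 'I_n, k != l -> u i k * star (u i l) = 0
    & forall i j k : 'I_n, i != j -> u i k * star (u j k) = 0].

End Relations.

(* The universal unital C*-algebra of the relations, described by its universal
   property: u generates A as a unital C*-algebra, and every solution v of the
   relations is the image of u under a unital *-homomorphism.  Such a
   homomorphism is automatically contractive, hence it is unique. *)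
Definition is_universal_UKn (R : realType) (n : nat) (A : cstarAlgType R)
    (u : 'M[A]_n) : Prop :=
  [/\ UKn_relations u,
      cstar_generated (1 |` [set a | exists i j, a = u i j]) = setT
    & forall (B : cstarAlgType R) (v : 'M[B]_n), UKn_relations v ->
        exists phi : {lrmorphism A -> B},
          (forall a, phi (star a) = star (phi a)) /\
          (forall i j, phi (u i j) = v i j)].

(* C(Qut(U_{K_n})) inside the universal algebra A with generators u. *)
Definition C_Qut_UKn (R : realType) (n : nat) (A : cstarAlgType R)
    (u : 'M[A]_n) : set A :=
  cstar_generated [set a | exists i j k l, a = star (u i j) * u k l].

(* Main.v *)
(* For unitaries w_1, ..., w_n of any C*-algebra, the matrix diag(w_1, ..., w_n)
   satisfies the relations.  In the 2x2 complex matrices with the operator norm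
   take w_1 = 1, w_2 and w_3 two non-commuting Pauli matrices and w_i = 1 for
   i > 3: under the universal property the words u_11^* u_22 and u_11^* u_33
   are mapped to w_2 and w_3, hence they do not commute. *)
Require Import Defs.
From HB Require Import structures.
From mathcomp Require Import all_boot all_order all_algebra.
From mathcomp Require Import complex.
From mathcomp Require Import all_classical all_reals all_analysis.
From mathcomp Require Import ring.
Set Implicit Arguments.
Unset Strict Implicit.
Unset Printing Implicit Defensive.
Import Order.TTheory GRing.Theory Num.Theory.
Import numFieldNormedType.Exports.
Import ComplexField.Normc.
Local Open Scope classical_set_scope.
Local Open Scope ring_scope.

(** * The modulus of complex numbers *)

Section Normc.
Context {R : realType}.
Implicit Types z : R[i].

Lemma normc_ge0 z : 0 <= normc z.
Proof. by case: z => a b; exact: sqrtr_ge0. Qed.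

Lemma normc_conj z : normc z^*%C = normc z.
Proof. by case: z => a b /=; rewrite sqrrN. Qed.

Lemma mul_conjc z : z^*%C * z = (normc z ^+ 2)%:C%C.
Proof.
case: z => a b; rewrite /= sqr_sqrtr ?addr_ge0 ?sqr_ge0//.
by apply/eqP; rewrite eq_complex /=; apply/andP; split; apply/eqP; ring.
Qed.

Lemma normc_real (x : R) : normc x%:C%C = `|x|.
Proof. by rewrite /= expr0n addr0 sqrtr_sqr. Qed.

Lemma normc_sum (I : finType) (F : I -> R[i]) :
  normc (\sum_i F i) <= \sum_i normc (F i).
Proof.
elim/big_rec2: _ => [|i y x _ ih]; first by rewrite normc0.
by apply: (le_trans (le_normcD _ _)); rewrite lerD2l.
Qed.

Lemma normRe_le z : `|complex.Re z| <= normc z.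
Proof.
by case: z => a b /=; rewrite -sqrtr_sqr ler_wsqrtr// lerDl sqr_ge0.
Qed.

Lemma normIm_le z : `|complex.Im z| <= normc z.
Proof.
by case: z => a b /=; rewrite -sqrtr_sqr ler_wsqrtr// lerDr sqr_ge0.
Qed.

Lemma normc_le_ReIm z : normc z <= `|complex.Re z| + `|complex.Im z|.
Proof.
case: z => a b /=; rewrite -[leRHS]ger0_norm ?addr_ge0// -sqrtr_sqr.
rewrite ler_wsqrtr// sqrrD !real_normK ?num_real//.
by rewrite lerD2r lerDl mulrn_wge0// mulr_ge0.
Qed.

End Normc.

(** * Finite sums of reals: Cauchy-Schwarz and limits *)

Lemma sum_cauchy_schwarz (R : realType) (I : finType) (a b : I -> R) :
  (\sum_i a i * b i) ^+ 2 <= (\sum_i a i ^+ 2) * (\sum_i b i ^+ 2).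
Proof.
(* Lagrange's identity *)
have lag : \sum_i \sum_j (a i * b j - a j * b i) ^+ 2 =
  ((\sum_i a i ^+ 2) * (\sum_i b i ^+ 2) - (\sum_i a i * b i) ^+ 2) *+ 2.
  transitivity (\sum_i \sum_j (a i ^+ 2 * b j ^+ 2 + b i ^+ 2 * a j ^+ 2
                  - (a i * b i) * (a j * b j) *+ 2)).
    by apply: eq_bigr => i _; apply: eq_bigr => j _; ring.
  under eq_bigr do rewrite sumrB big_split/= sumrMnl -!mulr_sumr.
  rewrite sumrB big_split/= sumrMnl -!mulr_suml; ring.
rewrite -subr_ge0 -(pmulrn_lge0 _ (isT : (0 < 2)%N)) -lag.
by apply: sumr_ge0 => i _; apply: sumr_ge0 => j _; exact: sqr_ge0.
Qed.

Lemma cvgr_sum (R : realType) (I : finType) (f : I -> nat -> R) (l : I -> R) :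
  (forall i, f i k @[k --> \oo] --> l i) ->
  \sum_i f i k @[k --> \oo] --> \sum_i l i.
Proof.
move=> fl; apply: (@cvg_big R I +%R 0 xpredT _ nat \oo _ f l) => //.
exact: add_continuous.
Qed.

(** * Conjugate transposes *)

Section Adjoint.
Context {R : realType}.

Definition adjmx m n (A : 'M[R[i]]_(m, n)) : 'M[R[i]]_(n, m) :=
  map_mx conjc A^T.

Lemma adjmxK m n (A : 'M[R[i]]_(m, n)) : adjmx (adjmx A) = A.
Proof. by apply/matrixP => i j; rewrite !mxE conjcK. Qed.

Lemma adjmxD m n (A B : 'M[R[i]]_(m, n)) : adjmx (A + B) = adjmx A + adjmx B.
Proof. by apply/matrixP => i j; rewrite !mxE rmorphD. Qed.

Lemma adjmxZ m n (z : R[i]) (A : 'M[R[i]]_(m, n)) :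
  adjmx (z *: A) = z^*%C *: adjmx A.
Proof. by apply/matrixP => i j; rewrite !mxE rmorphM. Qed.

Lemma adjmxM m n p (A : 'M[R[i]]_(m, n)) (B : 'M[R[i]]_(n, p)) :
  adjmx (A *m B) = adjmx B *m adjmx A.
Proof. by rewrite /adjmx trmx_mul map_mxM. Qed.

End Adjoint.

(** * Hermitian product and Euclidean norm on column vectors *)

Section EuclideanNorm.
Context {R : realType} {n : nat}.
Implicit Types x y : 'cV[R[i]]_n.

Definition cdot x y : R[i] := (adjmx x *m y) 0 0.

Definition enorm x : R := Num.sqrt (\sum_i normc (x i 0) ^+ 2).

Lemma enorm_ge0 x : 0 <= enorm x. Proof. exact: sqrtr_ge0. Qed.

Lemma cdotxx x : cdot x x = (enorm x ^+ 2)%:C%C.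
Proof.
rewrite sqr_sqrtr; last by apply: sumr_ge0 => i _; exact: sqr_ge0.
rewrite rmorph_sum /cdot mxE; apply: eq_bigr => i _.
by rewrite !mxE mul_conjc.
Qed.

Lemma normc_cdot_le x y : normc (cdot x y) <= enorm x * enorm y.
Proof.
rewrite -sqrtrM; last by apply: sumr_ge0 => i _; exact: sqr_ge0.
apply: (@le_trans _ _ (\sum_i normc (x i 0) * normc (y i 0))).
  rewrite /cdot mxE; apply: (le_trans (normc_sum _)); apply: ler_sum => i _.
  by rewrite !mxE normcM normc_conj.
rewrite -[leLHS]ger0_norm; last first.
  by apply: sumr_ge0 => i _; rewrite mulr_ge0 ?normc_ge0.
by rewrite -sqrtr_sqr ler_wsqrtr// sum_cauchy_schwarz.
Qed.

Lemma normc_le_enorm x i : normc (x i 0) <= enorm x.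
Proof.
rewrite -[leLHS]ger0_norm ?normc_ge0// -sqrtr_sqr ler_wsqrtr//.
by rewrite (bigD1 i)//= lerDl sumr_ge0// => j _; exact: sqr_ge0.
Qed.

Lemma enorm_delta i : enorm (delta_mx i 0) = 1.
Proof.
rewrite /enorm (bigD1 i)//= big1 ?addr0.
  by rewrite mxE !eqxx normc1 expr1n sqrtr1.
by move=> j /negPf ji; rewrite mxE ji normc0 expr0n.
Qed.

Lemma cdot_delta (A : 'M[R[i]]_n) i j :
  cdot (delta_mx i 0) (A *m delta_mx j 0) = A i j.
Proof.
rewrite /cdot -colE mxE (bigD1 i)//= big1 ?addr0 => [|k /negPf ki].
  by rewrite !mxE !eqxx conjc1 mul1r.
by rewrite !mxE ki conjc0 mul0r.
Qed.

Lemma cdot_adj (A : 'M[R[i]]_n) x y :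
  cdot x (A *m y) = cdot (adjmx A *m x) y.
Proof. by rewrite /cdot adjmxM adjmxK mulmxA. Qed.

Lemma cdotC x y : cdot x y = (cdot y x)^*%C.
Proof.
have -> : cdot x y = (adjmx (adjmx y *m x)) 0 0 by rewrite adjmxM adjmxK.
by rewrite [LHS]mxE; congr conjc; rewrite mxE.
Qed.

End EuclideanNorm.

(** * The operator norm of square complex matrices *)

Section OperatorNorm.
Context {R : realType} {n : nat}.
Implicit Types (A B : 'M[R[i]]_n) (x y : 'cV[R[i]]_n) (c : R).

(* Bounding the sesquilinear form [<x, A y>] instead of [A y] makes the triangle
   inequality and the invariance under adjoints immediate. *)
Definition form_bound A : set R :=
  [set c | 0 <= c /\
     forall x y, normc (cdot x (A *m y)) <= c * (enorm x * enorm y)].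

Definition opnorm A : R := inf (form_bound A).

(** Makes [form_bound A] nonempty, so that its infimum is meaningful. The same bound later turns
    entrywise convergence into convergence in [opnorm]. *)
Lemma form_bound_sum A : form_bound A (\sum_i \sum_j normc (A i j)).
Proof.
split=> [|x y].
  by apply: sumr_ge0 => i _; apply: sumr_ge0 => j _; exact: normc_ge0.
rewrite /cdot mxE mulr_suml; apply: (le_trans (normc_sum _)).
apply: ler_sum => i _.
rewrite normcM [adjmx x 0 i]mxE [x^T 0 i]mxE normc_conj mxE.
apply: (@le_trans _ _ (normc (x i 0) * \sum_j normc (A i j) * normc (y j 0))).
  rewrite ler_wpM2l ?normc_ge0//; apply: (le_trans (normc_sum _)).
  by apply: ler_sum => j _; rewrite normcM.
rewrite mulr_suml mulr_sumr; apply: ler_sum => j _.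
rewrite mulrCA ler_wpM2l ?normc_ge0//.
by rewrite ler_pM ?normc_ge0 ?normc_le_enorm.
Qed.

Lemma opnorm_le A c : form_bound A c -> opnorm A <= c.
Proof. by move=> Ac; apply: ge_inf => //; exists 0 => d []. Qed.

Lemma opnorm_ge0 A : 0 <= opnorm A.
Proof.
apply: lb_le_inf => [|c []//].
by exists (\sum_i \sum_j normc (A i j)); exact: form_bound_sum.
Qed.

Lemma opnormP A x y :
  normc (cdot x (A *m y)) <= opnorm A * (enorm x * enorm y).
Proof.
have xy0 : 0 <= enorm x * enorm y by rewrite mulr_ge0 ?enorm_ge0.
have [xy|xy] := eqVneq (enorm x * enorm y) 0.
  (* Division is impossible here, but any admissible bound already forces the form to vanish at this
     pair. *)
  by have [_ /(_ x y)] := form_bound_sum A; rewrite xy !mulr0.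
have xy1 : 0 < enorm x * enorm y by rewrite lt_def xy.
rewrite -ler_pdivrMr//; apply: lb_le_inf => [|c [_ cA]].
  by exists (\sum_i \sum_j normc (A i j)); exact: form_bound_sum.
by rewrite ler_pdivrMr.
Qed.

(** An entry is the value of the form at two basis vectors. This yields definiteness of the norm and
    the Cauchy property of each entry in the completeness proof. *)
Lemma normc_le_opnorm A i j : normc (A i j) <= opnorm A.
Proof.
have := opnormP A (delta_mx i 0) (delta_mx j 0).
by rewrite cdot_delta !enorm_delta !mulr1.
Qed.

Lemma opnorm_le_sum A : opnorm A <= \sum_i \sum_j normc (A i j).
Proof. exact/opnorm_le/form_bound_sum. Qed.

(** Testing the form at the pair [A *m x], [x] gives the square of [enorm (A *m x)] on the left; one
    factor then cancels. *)
Lemma enorm_mulmx_le A x : enorm (A *m x) <= opnorm A * enorm x.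
Proof.
have [->|Ax] := eqVneq (enorm (A *m x)) 0.
  by rewrite mulr_ge0 ?opnorm_ge0 ?enorm_ge0.
have Ax0 : 0 < enorm (A *m x) by rewrite lt_def Ax enorm_ge0.
have := opnormP A (A *m x) x.
rewrite cdotxx normc_real ger0_norm ?sqr_ge0// expr2 mulrCA.
by rewrite ler_pM2l.
Qed.

Lemma opnorm0_eq0 A : opnorm A = 0 -> A = 0.
Proof.
move=> A0; apply/matrixP => i j; rewrite mxE; apply: eq0_normc.
by apply/le_anti; rewrite normc_ge0 -A0 normc_le_opnorm.
Qed.

Lemma opnormD_le A B : opnorm (A + B) <= opnorm A + opnorm B.
Proof.
apply: opnorm_le; split=> [|x y]; first by rewrite addr_ge0 ?opnorm_ge0.
rewrite mulmxDl /cdot mulmxDr mxE mulrDl.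
by apply: (le_trans (le_normcD _ _)); apply: lerD; exact: opnormP.
Qed.

Lemma opnormZ_le (z : R[i]) A : opnorm (z *: A) <= normc z * opnorm A.
Proof.
apply: opnorm_le; split=> [|x y]; first by rewrite mulr_ge0 ?opnorm_ge0 ?normc_ge0.
rewrite -scalemxAl /cdot -scalemxAr mxE normcM -mulrA ler_wpM2l ?normc_ge0//.
exact: opnormP.
Qed.

Lemma opnormZ (z : R[i]) A : opnorm (z *: A) = normc z * opnorm A.
Proof.
apply/le_anti; rewrite opnormZ_le /=.
have [->|z0] := eqVneq z 0; first by rewrite normc0 mul0r opnorm_ge0.
have nz : 0 < normc z.
  by rewrite lt_def normc_ge0 andbT; apply: contra z0 => /eqP/eq0_normc ->.
(* The reverse inequality is the direct one for the inverse scalar. *)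
have := opnormZ_le z^-1 (z *: A).
by rewrite scalerA mulVf// scale1r normcV ler_pdivlMl.
Qed.

Lemma opnorm_adj_le A : opnorm (adjmx A) <= opnorm A.
Proof.
apply: opnorm_le; split=> [|x y]; first exact: opnorm_ge0.
by rewrite cdot_adj adjmxK cdotC normc_conj [enorm x * _]mulrC opnormP.
Qed.

Lemma opnormM_le A B : opnorm (A *m B) <= opnorm A * opnorm B.
Proof.
apply: opnorm_le; split=> [|x y]; first by rewrite mulr_ge0 ?opnorm_ge0.
rewrite -mulmxA (le_trans (opnormP _ _ _))// -mulrA ler_wpM2l ?opnorm_ge0//.
by rewrite mulrCA ler_wpM2l ?enorm_ge0 ?enorm_mulmx_le.
Qed.

(** For the hard inequality, the squared norm of [A *m y] equals the form of [adjmx A *m A] at [y],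
    [y], hence is at most [c] times the squared norm of [y]. With Cauchy-Schwarz, [Num.sqrt c] is
    then a form bound for [A]. *)
Lemma opnorm_adjM A : opnorm (adjmx A *m A) = opnorm A ^+ 2.
Proof.
apply/le_anti/andP; split.
  by rewrite (le_trans (opnormM_le _ _))// expr2 ler_wpM2r ?opnorm_ge0 ?opnorm_adj_le.
set c := opnorm (adjmx A *m A).
suff : opnorm A <= Num.sqrt c.
  rewrite -(@ler_pXn2r _ 2)// ?nnegrE ?opnorm_ge0 ?sqrtr_ge0//.
  by rewrite sqr_sqrtr ?opnorm_ge0.
apply: opnorm_le; split=> [|x y]; first exact: sqrtr_ge0.
apply: (le_trans (normc_cdot_le _ _)); rewrite mulrCA ler_wpM2l ?enorm_ge0//.
rewrite -(@ler_pXn2r _ 2)// ?nnegrE ?mulr_ge0 ?enorm_ge0 ?sqrtr_ge0//.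
rewrite exprMn [Num.sqrt c ^+ 2]sqr_sqrtr ?opnorm_ge0//.
have := opnormP (adjmx A *m A) y y.
by rewrite -mulmxA cdot_adj adjmxK cdotxx normc_real ger0_norm ?sqr_ge0// -expr2.
Qed.

(** The limit is built entrywise from the completeness of the reals, since [opnorm] dominates every
    entry and is dominated by the sum of their moduli. *)
Lemma opnorm_complete (X : nat -> 'M[R[i]]_n) :
  (forall e : R, 0 < e -> exists N : nat, forall m n : nat,
     (N <= m)%N -> (N <= n)%N -> opnorm (X m - X n) < e) ->
  exists L, opnorm (X k - L) @[k --> \oo] --> (0 : R).
Proof.
move=> Xcauchy.
(* [f] stands for the real or the imaginary part; only its additivity and its domination by the
   modulus matter. *)
have real_cvg (f : R[i] -> R) : (forall z w, f (z - w) = f z - f w) ->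
    (forall z, `|f z| <= normc z) ->
    exists l : 'I_n -> 'I_n -> R, forall i j, f (X k i j) @[k --> \oo] --> l i j.
  move=> fB f_le.
  suff l i j : {l : R | f (X k i j) @[k --> \oo] --> l}.
    by exists (fun i j => sval (l i j)) => i j; exact: svalP (l i j).
  apply: cid; apply/cvg_ex/cauchy_cvgP/cauchyP => e e0.
  have [N XN] := Xcauchy e e0; exists (f (X N i j)); exists N => // k /= Nk.
  rewrite /ball/= -fB (le_lt_trans (f_le _))//.
  apply: le_lt_trans (XN N k (leqnn _) Nk).
  by have := normc_le_opnorm (X N - X k) i j; rewrite !mxE.
have ReB (z w : R[i]) : complex.Re (z - w) = complex.Re z - complex.Re w.
  by case: z w => ? ? [].
have ImB (z w : R[i]) : complex.Im (z - w) = complex.Im z - complex.Im w.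
  by case: z w => ? ? [].
have [a aP] := real_cvg _ ReB normRe_le.
have [b bP] := real_cvg _ ImB normIm_le.
pose L : 'M[R[i]]_n := \matrix_(i, j) Complex (a i j) (b i j).
exists L.
have entry i j : `|complex.Re (X k i j) - a i j| +
    `|complex.Im (X k i j) - b i j| @[k --> \oo] --> (0 : R).
  rewrite -[X in _ --> X](_ : `|a i j - a i j| + `|b i j - b i j| = 0).
    by apply: cvgD; apply: cvg_norm; apply: cvgB => //; exact: cvg_cst.
  by rewrite !subrr normr0 addr0.
(* The sum over all entries dominates [opnorm (X k - L)] and tends to 0, so a squeeze concludes. *)
have := cvgr_sum (fun i => cvgr_sum (entry i)).
rewrite big1 => [bnd0|i _]; last by rewrite big1.
apply: (squeeze_cvgr _ (cvg_cst 0) bnd0); near=> k.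
rewrite opnorm_ge0 (le_trans (opnorm_le_sum _))//.
apply: ler_sum => i _; apply: ler_sum => j _.
rewrite !mxE; case: (X k i j) => x y.
exact: normc_le_ReIm.
Unshelve. all: by end_near. Qed.

End OperatorNorm.

(** * Complex matrices as a C*-algebra *)

Section MatrixCStarAlgebra.
Context {R : realType} {n : nat}.

(** The size is a successor because matrices of size 0 would form the zero ring. *)
HB.instance Definition _ := isCStarAlgebra.Build R 'M[R[i]]_n.+1
  (@adjmxK R n.+1 n.+1) (@adjmxD R n.+1 n.+1) (@adjmxZ R n.+1 n.+1)
  (@adjmxM R n.+1 n.+1 n.+1) (@opnorm0_eq0 R n.+1) (@opnormD_le R n.+1)
  (@opnormZ R n.+1) (@opnormM_le R n.+1) (@opnorm_adjM R n.+1)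
  (@opnorm_complete R n.+1).

End MatrixCStarAlgebra.

(** * Diagonal solutions of the relations *)

Section DiagonalSolution.
Context {R : realType} {B : cstarAlgType R} {n : nat}.

Lemma star0 : star (0 : B) = 0.
Proof. by apply: (addrI (star (0 : B))); rewrite -starD !addr0. Qed.

Lemma star1 : star (1 : B) = 1.
Proof. by rewrite -[LHS]mul1r -[X in X * _]starK -starM mul1r starK. Qed.

Definition diag_family (w : 'I_n -> B) : 'M[B]_n :=
  \matrix_(i, j) if i == j then w i else 0.

Lemma diag_familyM (v w : 'I_n -> B) :
  diag_family v *m diag_family w = diag_family (fun i => v i * w i).
Proof.
apply/matrixP => i j; rewrite !mxE (bigD1 i)//= big1 ?addr0 => [|k ki].
  by rewrite !mxE eqxx; case: eqP => _; rewrite ?mulr0.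
by rewrite !mxE eq_sym (negPf ki) mul0r.
Qed.

Lemma mx_star_diag_family (w : 'I_n -> B) :
  mx_star (diag_family w) = diag_family (fun i => star (w i)).
Proof.
by apply/matrixP => i j; rewrite !mxE eq_sym; case: eqP => [->|_]; rewrite ?star0.
Qed.

(** Each row and each column has at most one nonzero entry, so two distinct entries of one row or
    column always include a 0; biunitarity reduces to unitarity since the matrix equals its
    transpose. *)
Lemma diag_family_relations (w : 'I_n -> B) :
  (forall i, star (w i) * w i = 1) -> (forall i, w i * star (w i) = 1) ->
  UKn_relations (diag_family w).
Proof.
move=> swK wsK.
have diag1 (v : 'I_n -> B) : (forall i, v i = 1) -> diag_family v = 1%:M.
  move=> v1; apply/matrixP => i j; rewrite !mxE v1.
  by case: eqP.
have wT : (diag_family w)^T = diag_family w.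
  by apply/matrixP => i j; rewrite !mxE eq_sym; case: eqP => [->|_].
have w_unitary : unitary (diag_family w).
  by rewrite /unitary mx_star_diag_family !diag_familyM; split; exact: diag1.
split; first by split; rewrite ?wT.
- move=> i k l kl; rewrite !mxE; case: eqP => [->|_]; last by rewrite mul0r.
  by rewrite (negPf kl) star0 mulr0.
- move=> i j k ij; rewrite !mxE; case: eqP => [<-|_]; last by rewrite mul0r.
  by rewrite eq_sym (negPf ij) star0 mulr0.
Qed.

End DiagonalSolution.

(** * Two anticommuting self-adjoint unitaries *)

Section PauliMatrices.
Context {R : realType}.

Definition pauliX : 'M[R[i]]_2 := \matrix_(i, j) (i != j)%:R.

Definition pauliZ : 'M[R[i]]_2 := \matrix_(i, j) ((-1) ^+ i *+ (i == j)).

Lemma star_pauliX : star pauliX = pauliX.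
Proof. by apply/matrixP => i j; rewrite !mxE eq_sym rmorph_nat. Qed.

Lemma star_pauliZ : star pauliZ = pauliZ.
Proof.
apply/matrixP => i j; rewrite !mxE eq_sym rmorphMn rmorphXn rmorphN1.
by case: eqP => [->|_].
Qed.

Lemma pauliXX : pauliX * pauliX = 1.
Proof.
apply/matrixP => i j; rewrite !mxE big_ord_recl big_ord1 !mxE.
by case: i j => [[|[|//]] ?] [[|[|//]] ?] /=; rewrite ?mulr0 ?mulr1 ?addr0 ?add0r.
Qed.

Lemma pauliZZ : pauliZ * pauliZ = 1.
Proof.
apply/matrixP => i j; rewrite !mxE big_ord_recl big_ord1 !mxE.
case: i j => [[|[|//]] ?] [[|[|//]] ?] /=;
  by rewrite ?mulr0n ?mulr1n ?mulr0 ?mul0r ?addr0 ?add0r ?mulr1 ?mulrNN ?mulr1.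
Qed.

Lemma pauliXZ_neq : pauliX * pauliZ <> pauliZ * pauliX.
Proof.
(* The entries at this position are -1 and 1, so equality would give 2 = 0. *)
move/matrixP/(_ 0 1); rewrite !mxE !big_ord_recl !big_ord0 !mxE /=.
rewrite !(mulr0n, mulr1n, mulr0, mul0r, mulr1, addr0, add0r, mul1r).
by move=> /eqP; rewrite eq_sym -subr_eq0 opprK -mulr2n pnatr_eq0.
Qed.

End PauliMatrices.

Theorem corollary2 (R : realType) (n : nat) (n_ge3 : (3 <= n)%N)
    (A : cstarAlgType R) (u : 'M[A]_n) (u_univ : is_universal_UKn u) :
  noncommutative (C_Qut_UKn u).
Proof.
have [_ _ univ] := u_univ.
(* Indices start at 0, so the values 1 and 2 designate the second and third diagonal entries. *)
pose w (i : 'I_n) : 'M[R[i]]_2 :=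
  if val i == 1%N then pauliX else if val i == 2 then pauliZ else 1.
have starw i : star (w i) = w i.
  by rewrite /w; do ?case: ifP => _; rewrite ?star_pauliX ?star_pauliZ ?star1.
have ww i : w i * w i = 1.
  by rewrite /w; do ?case: ifP => _; rewrite ?pauliXX ?pauliZZ ?mulr1.
have /univ[phi [phi_star phi_u]] : UKn_relations (diag_family w).
  by apply: diag_family_relations => i; rewrite starw ww.
have phiM a b : phi (a * b) = phi a * phi b by exact: rmorphM.
move=> comm.
pose i0 := Ordinal (leq_trans (isT : 0 < 3)%N n_ge3).
pose i1 := Ordinal (leq_trans (isT : 1 < 3)%N n_ge3).
pose i2 := Ordinal (leq_trans (isT : 2 < 3)%N n_ge3).
have gen j : C_Qut_UKn u (star (u i0 i0) * u j j).
  by apply: sub_gen_smallest; exists i0, i0, j, j.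
(* Since [w i0] is 1, the left factor of the word disappears under [phi]. *)
have phi_gen j : phi (star (u i0 i0) * u j j) = w j.
  by rewrite phiM phi_star !phi_u !mxE !eqxx starw mul1r.
apply: (@pauliXZ_neq R).
have := congr1 phi (comm _ _ (gen i1) (gen i2)).
by rewrite [LHS]phiM [RHS]phiM !phi_gen.
Qed.
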